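(* For every SRNT graph with parameters $(k,c)$, we have $k \ge 3c-1$.
   Context: An SRNT graph with parameters $(k,c)$, where $k,c$ are integers with $k\ge 3$ and $k>c\ge 1$, is a finite simple non-bipartite connected graph $X$ of diameter $2$ such that: $X$ is regular of degree $k$; any two adjacent vertices have no common neighbours; any two distinct non-adjacent vertices have exactly $c$ common neighbours. *)

(* Defs.v *)
From mathcomp Require Import all_boot.

Set Implicit Arguments.
Unset Strict Implicit.
Unset Printing Implicit Defensive.

(* A graph on a finite vertex type T is given by its
   adjacency relation e : rel T. *)

Section Graph.

Variables (T : finType) (e : rel T).

Definition simple_graph : Prop := symmetric e /\ irreflexive e.

Definition connected_graph : Prop :=
  0 < #|T| /\ forall x y : T, connect e x y.

Definition bipartite_graph : Prop :=
  exists A : {set T}, forall x y : T, e x y -> (x \in A) != (y \in A).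

Definition neighbours (x : T) : {set T} := [set y | e x y].

Definition common_neighbours (x y : T) : {set T} :=
  neighbours x :&: neighbours y.

(* [path e x p] says that x :: p is a walk; its number of edges is [size p]. *)
Definition is_distance (x y : T) (n : nat) : Prop :=
  (exists p : seq T, [/\ path e x p, last x p = y & size p = n]) /\
  (forall p : seq T, path e x p -> last x p = y -> n <= size p).

Definition is_diameter (d : nat) : Prop :=
  (forall x y : T, exists2 n : nat, is_distance x y n & n <= d) /\
  (exists x y : T, is_distance x y d).

Definition regular_graph (k : nat) : Prop :=
  forall x : T, #|neighbours x| = k.

Record SRNT (k c : nat) : Prop := {
  SRNT_k_ge3 : 3 <= k;
  SRNT_c_ge1 : 1 <= c;
  SRNT_c_lt_k : c < k;
  SRNT_simple : simple_graph;
  SRNT_nonbipartite : ~ bipartite_graph;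
  SRNT_connected : connected_graph;
  SRNT_diameter : is_diameter 2;
  SRNT_regular : regular_graph k;
  SRNT_adjacent :
    forall x y : T, e x y -> common_neighbours x y = set0;
  SRNT_nonadjacent :
    forall x y : T, x != y -> ~~ e x y -> #|common_neighbours x y| = c
}.

End Graph.

(* Main.v *)
Require Import Defs.
From mathcomp Require Import all_boot.
From mathcomp Require Import all_order all_algebra ring lra.
From mathcomp Require Import realalg.

(** The bound is the Krein condition for the smaller eigenvalue of the graph.

    Let A be the adjacency matrix, J the all-ones matrix and n the number of
    vertices. Since A^2 = (k - c) I - c A + c J ([SRNT_adj_sqr]), the
    eigenvalues of A other than k are the roots of X^2 + c X = k - c, namely
    some r > 0 and -(r + c). The matrix E = r I - A + u J, for the u that
    makes E vanish on the all-ones vector, then satisfies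
    E^2 = (c + 2 r) E ([SRNT_eigenprojection_sqr]): it is a positive multiple
    of the orthogonal projection on the eigenspace of -(r + c). So E is a Gram
    matrix, hence so is its entrywise cube (Schur), and therefore the sum of
    the cubes of the entries of E is nonnegative ([sum_cube_ge0]). As E takes
    one value on the diagonal, one on edges and one on non-edges, this sum is
    explicit ([SRNT_cube_row_sum]); up to a positive factor it equals
    r (r + 1) - c, so c <= r (r + 1) ([SRNT_krein]).

    To conclude, k = r^2 + r c + c. If c >= 2 the inequality forces r >= 1,
    and replacing r^2 by its lower bound c - r gives
    k - (3 c - 1) >= (r - 1) (c - 1) >= 0. The case c = 1 is clear. The
    eigenvalue r may be irrational, so the argument is run over the real
    algebraic numbers. *)

Set Implicit Arguments.
Unset Strict Implicit.
Unset Printing Implicit Defensive.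

Import Order.TTheory GRing.Theory Num.Theory.

(** * Gram kernels and the Schur product *)

Section GramKernels.

Local Open Scope ring_scope.

Variables (T : finType) (R : realDomainType).
Implicit Types K L : T -> T -> R.

(** Positive semidefiniteness, in the form of a factorization: closure under
    entrywise products is then immediate, without any spectral theory. *)
Definition gram_kernel K : Prop :=
  exists (J : finType) (F : T -> J -> R),
    forall x y, K x y = \sum_j F x j * F y j.

(** Schur product theorem: the tensor products of the vectors that represent
    the two kernels represent their entrywise product. *)
Lemma gram_kernel_mul K L :
  gram_kernel K -> gram_kernel L -> gram_kernel (fun x y => K x y * L x y).
Proof.
move=> [I [F KF]] [J [G LG]].
exists (I * J)%type, (fun x p => F x p.1 * G x p.2) => x y.
rewrite KF LG big_distrlr pair_big /=.
by apply: eq_bigr => p _; rewrite mulrACA.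
Qed.

(** The sum of all entries is the squared norm of the sum of the vectors. *)
Lemma gram_kernel_sum_ge0 K :
  gram_kernel K -> 0 <= \sum_x \sum_y K x y.
Proof.
move=> [J [F KF]].
suff -> : \sum_x \sum_y K x y = \sum_j (\sum_x F x j) ^+ 2.
  by apply: sumr_ge0 => j _; exact: sqr_ge0.
under eq_bigr => x _ do under eq_bigr => y _ do rewrite KF.
under eq_bigr => x _ do rewrite exchange_big.
rewrite exchange_big; apply: eq_bigr => j _ /=.
by rewrite expr2 big_distrlr.
Qed.

(** A multiple l > 0 of an orthogonal projection is Gram up to the factor l,
    its rows being the representing vectors; so its entrywise cube is too. *)
Lemma sum_cube_ge0 K (l : R) :
    0 < l -> (forall x y, K x y = K y x) ->
    (forall x y, \sum_z K x z * K z y = l * K x y) ->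
  0 <= \sum_x \sum_y K x y ^+ 3.
Proof.
move=> l0 Ksym KK.
have gK : gram_kernel (fun x y => l * K x y).
  exists T, K => x y; rewrite -KK.
  by apply: eq_bigr => z _; rewrite (Ksym y).
have := gram_kernel_sum_ge0 (gram_kernel_mul gK (gram_kernel_mul gK gK)).
suff -> : \sum_x \sum_y l * K x y * (l * K x y * (l * K x y)) =
          l ^+ 3 * \sum_x \sum_y K x y ^+ 3.
  by rewrite pmulr_rge0 ?exprn_gt0.
rewrite mulr_sumr; apply: eq_bigr => x _.
rewrite mulr_sumr; apply: eq_bigr => y _; ring.
Qed.

End GramKernels.

(** * The Krein condition *)

Section Krein.

Local Open Scope ring_scope.

Variables (T : finType) (e : rel T) (k c : nat).
Hypothesis hX : SRNT e k c.
Variable R : realFieldType.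

Let adj (x y : T) : R := (e x y)%:R.
Let delta (x y : T) : R := (x == y)%:R.
Let n : R := #|T|%:R.

Lemma SRNT_adjC x y : adj x y = adj y x.
Proof. by rewrite /adj (SRNT_simple hX).1. Qed.

Lemma sum_delta_l x (f : T -> R) : \sum_z delta x z * f z = f x.
Proof.
rewrite (bigD1 x) //= /delta eqxx mul1r big1 ?addr0 // => z zx.
by rewrite eq_sym (negPf zx) mul0r.
Qed.

Lemma SRNT_row_sum x : \sum_y adj x y = k%:R.
Proof.
rewrite -(SRNT_regular hX x) -sum1_card natr_sum [RHS]big_mkcond /=.
by apply: eq_bigr => y _; rewrite inE /adj; case: (e x y).
Qed.

(** Entry (x, y) of A^2 counts the common neighbours of x and y, which gives
    A^2 = (k - c) I - c A + c J. *)
Lemma SRNT_adj_sqr x y :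
  \sum_z adj x z * adj z y =
  (k%:R - c%:R) * delta x y - c%:R * adj x y + c%:R.
Proof.
have -> : \sum_z adj x z * adj z y = #|common_neighbours e x y|%:R.
  rewrite -sum1_card natr_sum [RHS]big_mkcond /=; apply: eq_bigr => z _.
  rewrite !inE (SRNT_adjC z) /adj.
  by case: (e x z); case: (e y z); rewrite ?mulr0 ?mulr1.
rewrite /delta /adj; have [<-|xy] := eqVneq x y.
  rewrite /common_neighbours setIid (SRNT_regular hX) (SRNT_simple hX).2 /=; ring.
have [exy|nexy] := boolP (e x y).
  by rewrite (SRNT_adjacent hX exy) cards0 /=; ring.
rewrite (SRNT_nonadjacent hX xy nexy) /=; ring.
Qed.

(** Row sums of the formula for A^2: the walks of length two from a vertex
    number k^2. *)
Lemma SRNT_order :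
  n * c%:R = k%:R * k%:R - k%:R + c%:R + k%:R * c%:R.
Proof.
have /card_gt0P[x _] := (SRNT_connected hX).1.
have : \sum_y \sum_z adj x z * adj z y = k%:R * k%:R.
  rewrite exchange_big /=; under eq_bigr do rewrite -mulr_sumr SRNT_row_sum.
  by rewrite -mulr_suml SRNT_row_sum.
under eq_bigr do rewrite SRNT_adj_sqr.
rewrite !big_split /= -mulr_sumr sumrN -mulr_sumr SRNT_row_sum sumr_const.
have -> : \sum_y delta x y = 1.
  by rewrite -(sum_delta_l x (fun=> 1)); apply: eq_bigr => y _; rewrite mulr1.
rewrite -mulr_natl -/n => h; lra.
Qed.

Variable r : R.
Hypothesis r_gt0 : 0 < r.
Hypothesis r_root : r ^+ 2 + c%:R * r = k%:R - c%:R.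

(* This u equals (k - r) / n, the value for which E kills the all-ones vector;
   the present form has a denominator free of n. *)
Let u : R := c%:R / (k%:R + c%:R + r).
Let E (x y : T) : R := r * delta x y - adj x y + u.

Let D_gt0 : 0 < k%:R + c%:R + r.
Proof. by rewrite ltr_wpDl // addr_ge0. Qed.

Let uD : u * (k%:R + c%:R + r) = c%:R.
Proof. by rewrite /u divfK // gt_eqF. Qed.

Let c_gt0 : 0 < c%:R :> R.
Proof. by rewrite ltr0n (SRNT_c_ge1 hX). Qed.

Let k_gt0 : 0 < k%:R :> R.
Proof. by rewrite ltr0n (leq_trans _ (SRNT_k_ge3 hX)). Qed.

Let kE : k%:R = r ^+ 2 + c%:R * r + c%:R.
Proof. by rewrite r_root; ring. Qed.

Let un : u * n = k%:R - r.
Proof.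
apply: (mulIf (lt0r_neq0 D_gt0)).
have -> : u * n * (k%:R + c%:R + r) = n * c%:R.
  by rewrite mulrAC uD mulrC.
rewrite SRNT_order kE; ring.
Qed.

(** On the all-ones vector E is 0; on its orthogonal complement E acts as
    r - A, that is as 0 on the eigenspace of r and as c + 2 r on that of
    -(r + c). *)
Lemma SRNT_eigenprojection_sqr x y :
  \sum_z E x z * E z y = (c%:R + 2 * r) * E x y.
Proof.
have sum1 f z : \sum_t delta z t * f t = f z by exact: sum_delta_l.
transitivity (\sum_z (r * (delta x z * E z y) - r * (delta y z * adj x z)
   + adj x z * adj z y - u * adj x z + u * r * (delta y z * 1)
   - u * adj y z + u ^+ 2)).
  apply: eq_bigr => z _; rewrite /E (SRNT_adjC z y) /delta (eq_sym z y); ring.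
rewrite !(big_split, sumrN) /= sumr_const -(mulr_natl (u ^+ 2)) -/n.
rewrite -!mulr_sumr !sum1 SRNT_adj_sqr !SRNT_row_sum /E.
have -> : n * u ^+ 2 = u * (k%:R - r) by rewrite -un; ring.
have ur2 : u * r ^+ 2 = c%:R - u * (c%:R * r + 2 * c%:R + r).
  by rewrite -[X in X - _]uD kE; ring.
rewrite kE; ring: ur2.
Qed.

(** The entries of E are r + u on the diagonal, u - 1 on the k neighbours and
    u elsewhere; the n u^3 that arises is eliminated through n u = k - r. *)
Lemma SRNT_cube_row_sum x :
  \sum_y E x y ^+ 3 =
  - 2 * (k%:R - r) * u ^+ 2 + 3 * (r ^+ 2 + k%:R) * u + r ^+ 3 - k%:R.
Proof.
transitivity (\sum_y (u ^+ 3 + ((r + u) ^+ 3 - u ^+ 3) * (delta x y * 1)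
    + ((u - 1) ^+ 3 - u ^+ 3) * adj x y)).
  apply: eq_bigr => y _; rewrite /E /delta /adj; have [<-|_] := eqVneq x y.
    rewrite (SRNT_simple hX).2 /=; ring.
  by case: (e x y) => /=; ring.
rewrite !big_split /= sumr_const -(mulr_natl (u ^+ 3)) -/n.
rewrite -!mulr_sumr sum_delta_l SRNT_row_sum.
have -> : n * u ^+ 3 = (u * n) * u ^+ 2 by ring.
rewrite un; ring.
Qed.

(** All row sums of the entrywise cube of E are equal, so their common value f
    is nonnegative. Clearing the denominator of u and eliminating k, it
    factors as a positive quantity times r (r + 1) - c. *)
Lemma SRNT_krein : c%:R <= r * (r + 1).
Proof.
have l0 : 0 < c%:R + 2 * r by rewrite addr_gt0 // mulr_gt0.
have Esym x y : E x y = E y x.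
  by rewrite /E SRNT_adjC /delta eq_sym.
have := sum_cube_ge0 l0 Esym SRNT_eigenprojection_sqr.
under eq_bigr do rewrite SRNT_cube_row_sum.
rewrite sumr_const pmulrn_lge0; last by have [] := SRNT_connected hX.
set f := (X in 0 <= X) => f0.
have fE : f * (k%:R + c%:R + r) ^+ 2 =
          (r * (r + 1) * k%:R * (r + (c%:R - 1))) * (r * (r + 1) - c%:R).
  have -> : f * (k%:R + c%:R + r) ^+ 2 =
     - 2 * (k%:R - r) * (u * (k%:R + c%:R + r)) ^+ 2
     + 3 * (r ^+ 2 + k%:R) * (u * (k%:R + c%:R + r)) * (k%:R + c%:R + r)
     + (r ^+ 3 - k%:R) * (k%:R + c%:R + r) ^+ 2 by rewrite /f; ring.
  rewrite uD kE; ring.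
have : 0 <= f * (k%:R + c%:R + r) ^+ 2 by rewrite mulr_ge0 ?sqr_ge0.
have c1 : 0 <= c%:R - 1 :> R by rewrite subr_ge0 ler1n (SRNT_c_ge1 hX).
have t1 : 0 < r + (c%:R - 1) by rewrite ltr_wpDr.
by rewrite fE pmulr_rge0 ?subr_ge0 // !mulr_gt0 // addr_gt0.
Qed.

End Krein.

(** * The bound *)

Lemma positive_root_exists (R : rcfType) (b d : R) :
  (0 < d)%R -> exists2 r : R, (0 < r)%R & (r ^+ 2 + b * r = d)%R.
Proof.
move=> d0; set s := Num.sqrt (b ^+ 2 + 4 * d)%R.
have s2 : (s ^+ 2 = b ^+ 2 + 4 * d)%R.
  by rewrite sqr_sqrtr // addr_ge0 ?sqr_ge0 // mulr_ge0 // ltW.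
exists ((s - b) / 2)%R; last by lra.
have : (`|b| < s)%R.
  by rewrite -sqrtr_sqr ltr_sqrt; have := sqr_ge0 b; lra.
by move=> /(le_lt_trans (ler_norm b)); lra.
Qed.

Theorem corollary2 (T : finType) (e : rel T) (k c : nat)
  (hX : SRNT e k c) : 3 * c - 1 <= k.
Proof.
have c_ge1 := SRNT_c_ge1 hX.
have kc : (0 < k%:R - c%:R :> realalg)%R.
  by rewrite subr_gt0 ltr_nat (SRNT_c_lt_k hX).
have [r r0 rE] := positive_root_exists c%:R%R kc.
have krein := SRNT_krein hX r0 rE.
have [c1|c2] := leqP c 1.
  have -> : c = 1 by apply/eqP; rewrite eqn_leq c1.
  by apply: leq_trans (SRNT_k_ge3 hX).
have c2R : (2 <= c%:R :> realalg)%R by rewrite ler_nat.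
(* Otherwise r (r + 1) < 2 <= c. *)
have r1 : (1 <= r)%R by rewrite leNgt; apply/negP => rlt1; nra.
rewrite leq_subLR addnC -(ler_nat realalg) natrD natrM.
(* k - (3 c - 1) = (r - 1) (c - 1) + (r (r + 1) - c) *)
nra.
Qed.
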